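(* Let $f:\mathbb{R}^p\to\mathbb{R}$ be twice continuously differentiable and let $\rho\ge 0$. Then $\nabla f$ is $\rho$-order Lipschitz continuous if and only if there exist constants $C_0,C_1\ge 0$ such that $\Vert\nabla^2 f(x)\Vert_2\le C_0+C_1\Vert\nabla f(x)\Vert_2^{\rho}$ for all $x\in\mathbb{R}^p$.
   Context: $\Vert\cdot\Vert_2$ is the Euclidean norm for vectors and the induced operator (spectral) norm for matrices. Convention: $0^0=1$. A continuous function $D:\mathbb{R}^p\to\mathbb{R}^p$ is $\rho$-order Lipschitz continuous if there exist constants $C_0,C_1\ge 0$ and, for every $x\in\mathbb{R}^p$, there exists an open ball $B_x$ around $x$ (centered at $x$, of positive radius), such that $$\Vert D(x_1)-D(x_2)\Vert_2\le \left(C_0+C_1\Vert D(x)\Vert_2^{\rho}\right)\Vert x_1-x_2\Vert_2\quad\text{for all }x_1,x_2\in B_x.$$ The constants $C_0,C_1$ do not depend on $x$, and need not equal the constants in the Hessian bound. *)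

(* Defs.v *)
From HB Require Import structures.
From mathcomp Require Import all_boot all_order all_algebra.
From mathcomp Require Import all_classical all_reals all_analysis.

Set Implicit Arguments.
Unset Strict Implicit.
Unset Printing Implicit Defensive.
Import Order.TTheory GRing.Theory Num.Theory.
Import numFieldNormedType.Exports.

Local Open Scope classical_set_scope.
Local Open Scope ring_scope.

(* R^p is the type 'rV[R]_p of row vectors. The norm that
   the library puts on matrices is the sup norm, so the Euclidean norm is
   defined separately; both induce the same topology, hence the library's
   [continuous] and [differentiable] are used unchanged. *)

Definition norm2 (R : realType) (p : nat) (x : 'rV[R]_p) : R :=
  Num.sqrt (\sum_(i < p) x 0 i ^+ 2).

(* As for the library's Jacobian, a matrix A acts on row vectors by
   v |-> v *m A. The set below contains 0 and is bounded, so this [sup] is a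
   genuine supremum. *)
Definition opnorm2 (R : realType) (p : nat) (A : 'M[R]_p) : R :=
  sup [set norm2 (v *m A) | v in [set v : 'rV[R]_p | norm2 v <= 1]].

Definition gradient (R : realType) (p : nat) (f : 'rV[R]_p -> R)
    (x : 'rV[R]_p) : 'rV[R]_p :=
  \row_(i < p) 'D_(delta_mx 0 i) f x.

(* The (i, j) entry is the i-th partial derivative of the j-th partial
   derivative of f. *)
Definition hessian (R : realType) (p : nat) (f : 'rV[R]_p -> R)
    (x : 'rV[R]_p) : 'M[R]_p :=
  'J (gradient f) x.

Definition twice_continuously_differentiable (R : realType) (p : nat)
    (f : 'rV[R]_p -> R) : Prop :=
  [/\ forall x, differentiable f x,
      forall x, differentiable (gradient f) x
    & continuous (hessian f)].

Definition ball2 (R : realType) (p : nat) (x : 'rV[R]_p) (r : R) :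
    set 'rV[R]_p :=
  [set y | norm2 (y - x) < r].

(* The real power [powR], written `^, satisfies 0 `^ 0 = 1 and 0 `^ rho = 0
   for rho != 0. *)
Definition order_lipschitz (R : realType) (p : nat) (rho : R)
    (D : 'rV[R]_p -> 'rV[R]_p) : Prop :=
  continuous D /\
  exists C0 C1 : R, [/\ 0 <= C0, 0 <= C1 &
    forall x : 'rV[R]_p, exists r : R, 0 < r /\
      forall x1 x2 : 'rV[R]_p, ball2 x r x1 -> ball2 x r x2 ->
        norm2 (D x1 - D x2)
          <= (C0 + C1 * norm2 (D x) `^ rho) * norm2 (x1 - x2)].

(* Main.v *)
(* The Jacobian of D at x applied to v is the limit of (D (x + h v) - D x) / h,
   so a local Lipschitz constant of D around x bounds its spectral norm.
   Conversely, by continuity of the Hessian its spectral norm stays below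
   C0 + 1 + C1 |grad f x|^rho on a whole ball around x; the ball is convex, and
   the mean value theorem applied to t |-> <w, D (x2 + t (x1 - x2))> with
   w = D x1 - D x2 turns this bound into a Lipschitz bound. Only the constant
   C0 changes, and powR need not be shown continuous. *)
Require Import Defs.
From mathcomp Require Import all_boot all_order all_algebra.
From mathcomp Require Import all_classical all_reals all_analysis.
From mathcomp Require Import ring lra.
Import Order.TTheory GRing.Theory Num.Theory.
Import numFieldNormedType.Exports.
Local Open Scope ring_scope.

(** * Euclidean and spectral norms, and their comparison with the sup norm *)

Section EuclideanNorm.
Context {R : realType} {p : nat}.
Implicit Types (x y v : 'rV[R]_p) (A : 'M[R]_p) (c L : R).

Lemma norm2_ge0 x : 0 <= norm2 x.
Proof. exact: sqrtr_ge0. Qed.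

Lemma sqr_norm2 x : norm2 x ^+ 2 = \sum_(i < p) x 0 i ^+ 2.
Proof. by rewrite sqr_sqrtr// sumr_ge0// => i _; exact: sqr_ge0. Qed.

Lemma norm2_coord x i : `|x 0 i| <= norm2 x.
Proof.
rewrite -sqrtr_sqr ler_wsqrtr// (bigD1 i)//= lerDl sumr_ge0// => j _.
exact: sqr_ge0.
Qed.

Lemma norm2_eq0 x : norm2 x = 0 -> x = 0.
Proof.
move=> x0; apply/rowP => i; apply/eqP; rewrite mxE -normr_le0 -x0.
exact: norm2_coord.
Qed.

Lemma norm2Z c x : norm2 (c *: x) = `|c| * norm2 x.
Proof.
rewrite /norm2 -sqrtr_sqr -sqrtrM ?sqr_ge0// mulr_sumr.
by congr Num.sqrt; apply: eq_bigr => i _; rewrite mxE exprMn.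
Qed.

Lemma norm2_0 : norm2 (0 : 'rV[R]_p) = 0.
Proof. by rewrite -(scale0r 0) norm2Z normr0 mul0r. Qed.

(** The sum of the squares [(norm2 y * x 0 i - norm2 x * y 0 i) ^+ 2] is nonnegative and expands to
    2|x||y|(|x||y| - <x,y>); a positive |x||y| can be cancelled. *)
Lemma norm2_cauchy_schwarz x y :
  \sum_(i < p) x 0 i * y 0 i <= norm2 x * norm2 y.
Proof.
have [/eqP|xy0] := eqVneq (norm2 x * norm2 y) 0.
  rewrite mulf_eq0 => /orP[] /eqP /norm2_eq0 ->;
    rewrite norm2_0 ?mul0r ?mulr0 big1// => i _.
    by rewrite mxE mul0r.
  by rewrite mxE mulr0.
have xy_gt0 : 0 < norm2 x * norm2 y.
  by rewrite lt_neqAle eq_sym xy0 mulr_ge0 ?norm2_ge0.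
have : 0 <= \sum_(i < p) (norm2 y * x 0 i - norm2 x * y 0 i) ^+ 2.
  by rewrite sumr_ge0// => i _; exact: sqr_ge0.
rewrite (eq_bigr (fun i =>
    norm2 y ^+ 2 * x 0 i ^+ 2 + norm2 x ^+ 2 * y 0 i ^+ 2
    - 2 * (norm2 x * norm2 y) * (x 0 i * y 0 i))); last by move=> i _; ring.
rewrite sumrB big_split/= -!mulr_sumr -!sqr_norm2.
by move=> h; rewrite -subr_ge0 -(pmulr_rge0 _ xy_gt0); lra.
Qed.

Lemma norm2D x y : norm2 (x + y) <= norm2 x + norm2 y.
Proof.
rewrite -(@ler_pXn2r _ 2)// ?nnegrE ?addr_ge0 ?norm2_ge0//.
rewrite sqr_norm2; under eq_bigr => i _ do rewrite mxE sqrrD.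
rewrite !big_split/= -!sqr_norm2 sqrrD lerD2r lerD2l.
by rewrite mulr2n lerD// norm2_cauchy_schwarz.
Qed.

Lemma norm2_le_sum x : norm2 x <= \sum_(i < p) `|x 0 i|.
Proof.
have [->|x0] := eqVneq (norm2 x) 0; first exact: sumr_ge0.
have x_gt0 : 0 < norm2 x by rewrite lt_neqAle eq_sym x0 norm2_ge0.
rewrite -(ler_pM2l x_gt0) -expr2 sqr_norm2 mulr_sumr ler_sum// => i _.
by rewrite -real_normK ?num_real// expr2 ler_wpM2r// norm2_coord.
Qed.

Lemma norm2_le_mx_norm x : norm2 x <= p%:R * `|x|.
Proof.
apply: (le_trans (norm2_le_sum x)).
rewrite -[p in p%:R]card_ord mulr_natl -sumr_const ler_sum// => i _.
by rewrite [leRHS]/Num.norm/= mx_normrE (le_bigmax _ _ (0, i)).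
Qed.

Lemma norm2_mulmx v A :
  norm2 (v *m A) <= (\sum_(i < p) norm2 (row i A)) * norm2 v.
Proof.
rewrite mulmx_sum_row mulr_suml.
have : norm2 (\sum_(i < p) v 0 i *: row i A)
    <= \sum_(i < p) norm2 (v 0 i *: row i A).
  elim/big_ind2: _ => [|x a y b xa yb|//]; first by rewrite norm2_0.
  by rewrite (le_trans (norm2D _ _))// lerD.
move/le_trans; apply; apply: ler_sum => i _.
by rewrite norm2Z mulrC ler_wpM2l ?norm2_ge0 ?norm2_coord.
Qed.

(** Continuity of the Hessian is stated in the sup norm of matrices; this crude factor p^2 converts
    it into a Euclidean estimate. *)
Lemma norm2_mulmx_mx_norm v A :
  norm2 (v *m A) <= p%:R * (p%:R * `|A|) * norm2 v.
Proof.
apply: (le_trans (norm2_mulmx v A)); rewrite ler_wpM2r ?norm2_ge0//.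
rewrite -[X in X%:R * (_ * _)]card_ord mulr_natl -sumr_const ler_sum// => i _.
apply: (le_trans (norm2_le_mx_norm _)); rewrite ler_wpM2l ?ler0n//.
rewrite [leLHS]/Num.norm/= mx_normrE bigmax_le// => -[j k] _.
by rewrite mxE [leRHS]/Num.norm/= mx_normrE (le_bigmax _ _ (i, k)).
Qed.

(** Rescaling v to unit length gives a member of the set under the [sup], which [norm2_mulmx] shows
    to be bounded. *)
Lemma opnorm2_ub v A : norm2 (v *m A) <= opnorm2 A * norm2 v.
Proof.
have [v0|v0] := eqVneq (norm2 v) 0.
  by rewrite (norm2_eq0 _ v0) mul0mx norm2_0 mulr0.
have v_gt0 : 0 < norm2 v by rewrite lt_neqAle eq_sym v0 norm2_ge0.
rewrite -ler_pdivrMr// mulrC -[X in X * _]gtr0_norm ?invr_gt0//.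
rewrite -norm2Z scalemxAl; apply: ub_le_sup.
  exists (\sum_(i < p) norm2 (row i A)) => _ [w /= w1 <-].
  apply: (le_trans (norm2_mulmx _ _)); rewrite ler_piMr ?sumr_ge0// => i _.
  exact: norm2_ge0.
exists ((norm2 v)^-1 *: v) => //=.
by rewrite norm2Z gtr0_norm ?invr_gt0// mulVf.
Qed.

Lemma opnorm2_le A L :
  (forall v, norm2 (v *m A) <= L * norm2 v) -> 0 <= L -> opnorm2 A <= L.
Proof.
move=> AL L0; apply: ge_sup => [|_ [v /= v1 <-]].
  by exists (norm2 (0 *m A)), 0 => //=; rewrite norm2_0.
by rewrite (le_trans (AL v))// ler_piMr.
Qed.

End EuclideanNorm.

(** * Local Lipschitz bounds versus bounds on the Jacobian *)

Section LipschitzJacobian.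
Local Open Scope classical_set_scope.
Local Open Scope ring_scope.
Context {R : realType} {p : nat}.
Implicit Types (x v w : 'rV[R]_p) (D : 'rV[R]_p -> 'rV[R]_p) (r L : R).

Lemma norm2_continuous : continuous (@norm2 R p).
Proof.
have sum_continuous : continuous (fun y : 'rV[R]_p => \sum_(i < p) y 0 i ^+ 2).
  apply: continuous_big => [|i _ x]; first exact: add_continuous.
  apply: (@continuous_comp _ _ _ (fun y : 'rV[R]_p => y 0 i) (fun t => t ^+ 2)).
    exact: coord_continuous.
  exact: exprn_continuous.
move=> x; apply: (@continuous_comp _ _ _ _ (@Num.sqrt R)).
  exact: sum_continuous.
exact: sqrt_continuous.
Qed.

Lemma mx_norm_le_norm2 x : `|x| <= norm2 x.
Proof.
rewrite [leLHS]/Num.norm/= mx_normrE bigmax_le ?norm2_ge0// => -[j k] _/=.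
by rewrite ord1 norm2_coord.
Qed.

Lemma lipschitz_opnorm2_jacobian D x r L : differentiable D x -> 0 < r -> 0 <= L ->
  (forall x1 x2, ball2 x r x1 -> ball2 x r x2 ->
     norm2 (D x1 - D x2) <= L * norm2 (x1 - x2)) ->
  opnorm2 ('J D x) <= L.
Proof.
move=> Dx r0 L0 lipD; apply: opnorm2_le => // v.
rewrite -deriveEjacobian//.
have /cvg_ex[/= l Dl] := diff_derivable (v := v) Dx.
rewrite /derive (cvg_lim _ Dl)//.
apply: (cvgr_to_le (cvg_comp _ _ Dl (norm2_continuous l))).
(* For |h| below this bound, x + h v lies in the ball; the added 1 keeps the denominator positive
   when v = 0. *)
have r'_gt0 : 0 < r / (norm2 v + 1).
  by rewrite divr_gt0// ltr_wpDl ?norm2_ge0.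
near=> h.
have h0 : h != 0 by near: h; exact: nbhs_dnbhs_neq.
have hr : `|h| < r / (norm2 v + 1).
  by near: h; apply: dnbhs0_lt.
rewrite /= norm2Z normfV ler_pdivrMl ?normr_gt0// mulrCA -norm2Z.
rewrite -[in leRHS](addrK x (h *: v)); apply: lipD; rewrite /ball2/=.
  rewrite addrK norm2Z (le_lt_trans (y := `|h| * (norm2 v + 1)))//.
    by rewrite ler_wpM2l// lerDl.
  by rewrite -ltr_pdivlMr// ltr_wpDl ?norm2_ge0.
by rewrite subrr norm2_0.
Unshelve. all: by end_near. Qed.

(** The linear form <w, .> is continuous and maps the difference quotients of D along v to those of
    the scalar function, so the limit carries over. *)
Lemma is_derive_scalar_line D w x v t : differentiable D (x + t *: v) ->
  is_derive t 1 (fun s => \sum_(i < p) w 0 i * D (x + s *: v) 0 i)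
    (\sum_(i < p) w 0 i * (v *m 'J D (x + t *: v)) 0 i).
Proof.
move=> Dx; rewrite -deriveEjacobian//.
have /cvg_ex[/= l Dl] := diff_derivable (v := v) Dx.
rewrite [in X in is_derive _ _ _ X]/derive (cvg_lim _ Dl)//.
have lin_continuous : continuous (fun y : 'rV[R]_p => \sum_(i < p) w 0 i * y 0 i).
  apply: continuous_big => [|i _ y]; first exact: add_continuous.
  apply: (@continuous_comp _ _ _ (fun y : 'rV[R]_p => y 0 i) (fun t => w 0 i * t)).
    exact: coord_continuous.
  exact: mulrl_continuous.
have := cvg_comp _ _ Dl (lin_continuous l).
set q := (_ \o _); set q' := fun h : R => h^-1 *:
  (((fun s => \sum_(i < p) w 0 i * D (x + s *: v) 0 i) \o shift t) (h *: 1)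
   - \sum_(i < p) w 0 i * D (x + t *: v) 0 i).
have -> : q = q'.
  apply/funext => h; rewrite /q /q' /= -sumrB scaler_sumr.
  apply: eq_bigr => i _; rewrite !mxE -mulrBr scalerAr.
  congr (_ * (_ * (D _ 0 i - _))).
  by rewrite [h *: 1]mulr1 scalerDl addrCA.
move=> q'l; apply: DeriveDef; first exact: cvgP q'l.
exact: cvg_lim.
Qed.

(** Pairing with w = D x1 - D x2 makes the scalar mean value theorem applicable: |w|^2 = <w, u J>
    for J the Jacobian at some point of the segment, and Cauchy-Schwarz lets one factor |w|
    cancel. *)
Lemma mean_value_norm2 D x1 x2 L : (forall x, differentiable D x) ->
  (forall t v, 0 < t < 1 ->
     norm2 (v *m 'J D (x2 + t *: (x1 - x2))) <= L * norm2 v) ->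
  norm2 (D x1 - D x2) <= L * norm2 (x1 - x2).
Proof.
move=> diffD JL.
have [->|w0] := eqVneq (norm2 (D x1 - D x2)) 0.
  (* If w = 0, the right-hand side must still be shown nonnegative; [JL] at the midpoint bounds it
     below by a norm. *)
  have h : 0 < 2^-1 :> R by lra.
  have h1 : 2^-1 < 1 :> R by lra.
  by apply: le_trans (norm2_ge0 _) (JL 2^-1 (x1 - x2) _); rewrite h h1.
have w_gt0 : 0 < norm2 (D x1 - D x2) by rewrite lt_neqAle eq_sym w0 norm2_ge0.
set w := D x1 - D x2 in w0 w_gt0 *; set u := x1 - x2 in JL *.
pose phi s := \sum_(i < p) w 0 i * D (x2 + s *: u) 0 i.
have dphi t := is_derive_scalar_line D w x2 u t (diffD _).
have [|c c01 phi10] := @MVT R phi _ 0 1 ltr01 (fun t _ => dphi t).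
  by apply: derivable_within_continuous => t _; case: (dphi t).
have {phi10} : norm2 w ^+ 2 =
    \sum_(i < p) w 0 i * (u *m 'J D (x2 + c *: u)) 0 i.
  move: phi10; rewrite subr0 mulr1 => <-.
  rewrite /phi scale1r scale0r addr0 subrKC -sumrB sqr_norm2.
  by apply: eq_bigr => i _; rewrite -mulrBr /w !mxE expr2.
rewrite -(ler_pM2l w_gt0) -expr2 => ->.
apply: (le_trans (norm2_cauchy_schwarz _ _)).
by rewrite ler_wpM2l ?norm2_ge0// JL.
Qed.

End LipschitzJacobian.

Theorem lemma3 (R : realType) (p : nat) (f : 'rV[R]_p -> R) (rho : R)
    (hf : twice_continuously_differentiable f) (hrho : 0 <= rho) :
  order_lipschitz rho (gradient f) <->
  exists C0 C1 : R, [/\ 0 <= C0, 0 <= C1 &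
    forall x : 'rV[R]_p,
      opnorm2 (hessian f x) <= C0 + C1 * norm2 (gradient f x) `^ rho].
Proof.
have [_ diffD contH] := hf.
split=> [[_ [C0 [C1 [C00 C10 lipD]]]]|[C0 [C1 [C00 C10 HL]]]].
  exists C0, C1; split=> // x; have [r [r0 lipr]] := lipD x.
  apply: lipschitz_opnorm2_jacobian lipr => //.
  by rewrite addr_ge0// mulr_ge0// powR_ge0.
split; first by move=> x; exact: differentiable_continuous.
exists (C0 + 1), C1; split=> //; first exact: addr_ge0.
move=> x.
(* After the factor p^2 of [norm2_mulmx_mx_norm], this tolerance leaves at most 1, which is the 1
   added to C0; the denominator stays positive for p = 0. *)
have e_gt0 : 0 < (p%:R * p%:R + 1)^-1 :> R.
  by rewrite invr_gt0 ltr_wpDl// mulr_ge0.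
have /cvgrPdist_lt/(_ _ e_gt0) := contH x.
move=> /nbhs_ballP[r /= r0 Hr].
(* The sup-norm radius also serves as Euclidean radius, since the sup norm is at most [norm2]. *)
exists r; split=> // x1 x2 x1r x2r.
apply: mean_value_norm2 => // t v /andP[t0 t1].
set y := x2 + _.
have yr : `|x - y| < r.
  rewrite distrC (le_lt_trans (mx_norm_le_norm2 _))//.
  have -> : y - x = t *: (x1 - x) + (1 - t) *: (x2 - x).
    by apply/rowP => i; rewrite !mxE; ring.
  rewrite (le_lt_trans (norm2D _ _))// !norm2Z gtr0_norm// gtr0_norm ?subr_gt0//.
  by move: x1r x2r; rewrite /ball2/=; nra.
have Hy : `|'J (gradient f) y - 'J (gradient f) x| < (p%:R * p%:R + 1)^-1.
  by rewrite distrC; apply: Hr; rewrite -ball_normE.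
(* Split the Hessian at y into the Hessian at x, bounded by [HL], and a perturbation that
   contributes at most [norm2 v]. The gradient thus enters only at the centre x. *)
rewrite -['J (gradient f) y](subrKC ('J (gradient f) x)) mulmxDr.
apply: (le_trans (norm2D _ _)); rewrite addrAC mulrDl mul1r lerD//.
  by apply: (le_trans (opnorm2_ub _ _)); rewrite ler_wpM2r ?norm2_ge0 ?HL.
apply: (le_trans (norm2_mulmx_mx_norm _ _)).
rewrite ler_piMl ?norm2_ge0// mulrA.
rewrite (le_trans (y := (p%:R * p%:R + 1) * (p%:R * p%:R + 1)^-1))//.
  by rewrite ler_pM ?mulr_ge0 ?lerDl// ltW.
by rewrite mulfV// gt_eqF// -invr_gt0.
Qed.
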